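(* Let $\mathcal T$ be a set of tile designs for the rhombic dodecahedron with symmetry group the full octahedral group $O_h$ (order $48$). Suppose there are $t_{\mathrm{id}}$ tiles, of which $t_r$ are fixed under $180^\circ$ rotation of the rhombic face, $t_f$ are fixed under the reflection $f$ of the face that swaps the two endpoints of its short diagonal, and $t_{rf}$ are fixed under the reflection $rf$ of the face that swaps the two endpoints of its long diagonal. Then the number of ways of tiling the faces of the rhombic dodecahedron up to full octahedral symmetry $O_h$ is $$\frac{1}{48}\left(t_{\mathrm{id}}^{12}+6t_{\mathrm{id}}^3+3t_{\mathrm{id}}^6+8t_{\mathrm{id}}^4+6t_{\mathrm{id}}^5t_r^2+t_{\mathrm{id}}^6+6t_{\mathrm{id}}^3+3t_{\mathrm{id}}^4t_f^4+8t_{\mathrm{id}}^2+6t_{\mathrm{id}}^5t_{rf}^2\right)$$ $$=\frac{1}{48}\left(t_{\mathrm{id}}^{12}+4t_{\mathrm{id}}^6+8t_{\mathrm{id}}^4+12t_{\mathrm{id}}^3+8t_{\mathrm{id}}^2+6t_{\mathrm{id}}^5t_r^2+3t_{\mathrm{id}}^4t_f^4+6t_{\mathrm{id}}^5t_{rf}^2\right).$$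
   Context: Tilings. Let $P$ be a polyhedron with set of faces $\mathcal F$ and let $\mathcal A$ be a group of isometries of $P$, acting on $\mathcal F$. A set of tile designs is a finite set $\mathcal T$ together with a group action of $\mathcal A$ on $\mathcal T\times\mathcal F$ lying over the action on $\mathcal F$ (so $A\cdot(T,F)=(T',A\cdot F)$ for some $T'\in\mathcal T$). A tiling is a map $\tau:\mathcal F\to\mathcal T$; $\mathcal A$ acts on tilings by moving graphs: $A\cdot\tau$ is the tiling with $((A\cdot\tau)(A\cdot F),A\cdot F)=A\cdot(\tau(F),F)$ for all $F$. The number of ways of tiling up to $\mathcal A$ is the number of $\mathcal A$-orbits on the set of tilings. The induced symmetry group $G$ of a face $F$ is the group of isometries of $F$ realized by elements of the stabilizer $\mathcal A_F$; for $g\in G$, $t_g$ is the number of $T\in\mathcal T$ with $g\cdot(T,F)=(T,F)$, where $g$ acts via the element of $\mathcal A_F$ inducing it. Since $\mathcal A$ acts transitively on faces, $t_g$ does not depend on the choice of $F$. In particular $t_{\mathrm{id}}=|\mathcal T|$. Polyhedron and group. Here $\mathcal A=O_h$ is the group of order $48$ of all $3\times3$ signed permutation matrices. The rhombic dodecahedron is the convex hull of the $O_h$-orbits of $v=(1,0,0)$ and $v'=\frac12(1,1,1)$ ($6+8=14$ vertices, $12$ rhombic faces). Each face has two vertices in the orbit of $v$ (the endpoints of its long diagonal) and two in the orbit of $v'$ (the endpoints of its short diagonal). The induced symmetry group of a face is $D_2=\langle r,f\mid r^2=f^2=(rf)^2=e\rangle$, where $r$ is the $180^\circ$ rotation, $f$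 swaps the two $v'$-type vertices (fixing the $v$-type ones) and $rf$ swaps the two $v$-type vertices (fixing the $v'$-type ones). *)

(* Defs.v *)
From HB Require Import structures.
From mathcomp Require Import all_boot all_order all_fingroup all_algebra.
From mathcomp Require Import boolp classical_sets functions cardinality reals.
From mathcomp Require Import convex.

Set Implicit Arguments.
Unset Strict Implicit.
Unset Printing Implicit Defensive.

Import Order.TTheory GRing.Theory Num.Theory.

Local Open Scope classical_set_scope.
Local Open Scope ring_scope.

Section Polyhedra.
Variable R : realType.
Implicit Types (P F X : set 'cV[R]_3) (g h : 'M[R]_3).

Definition move g X : set 'cV[R]_3 := [set g *m x | x in X].

Definition convex_hull X : set 'cV[R]_3 :=
  smallest (@convex_set R 'cV[R]_3) X.

(* A face is a two-dimensional intersection of P with a supporting plane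
   a . x = b; the points x, y, z witness that it is not contained in a line. *)
Definition is_face P F : Prop :=
  exists (a : 'cV[R]_3) (b : R),
    [/\ a != 0,
        forall x, P x -> (a^T *m x) 0 0 <= b,
        F = [set x | P x /\ (a^T *m x) 0 0 = b] &
        exists x y z, [/\ F x, F y, F z & \rank (row_mx (y - x) (z - x)) = 2]].

Definition faces P : set (set 'cV[R]_3) := [set F | is_face P F].

(* Isometries fixing the origin, i.e., orthogonal matrices. *)
Record isometry_group P := IsometryGroup {
  iso_set :> set 'M[R]_3;
  iso_orthogonal : forall g, iso_set g -> g^T *m g = 1%:M;
  iso_preserves : forall g, iso_set g -> move g P = P;
  iso1 : iso_set 1%:M;
  isoM : forall g h, iso_set g -> iso_set h -> iso_set (g *m h);
  isoV : forall g, iso_set g -> iso_set (invmx g) }.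

Lemma face_move P (A : isometry_group P) g F :
  iso_set A g -> is_face P F -> is_face P (move g F).
Proof.
move=> Ag [a [b [a0 Pab FE [x [y [z [Fx Fy Fz xyz]]]]]]].
have gTg := iso_orthogonal Ag.
have [_ gU] := mulmx1_unit gTg.
have gaE w : (g *m a)^T *m (g *m w) = a^T *m w.
  by rewrite trmx_mul -mulmxA (mulmxA g^T) gTg mul1mx.
exists (g *m a), b; split.
- by apply: contra_neq a0 => ga0; rewrite -(mulKmx gU a) ga0 mulmx0.
- move=> w; rewrite -(iso_preserves Ag) => -[u Pu <-]; rewrite gaE; exact: Pab.
- apply/seteqP; split => [_ [u + <-]|w [Pw wb]].
    rewrite FE => -[Pu ub]; split; last by rewrite gaE.
    by rewrite -(iso_preserves Ag); exists u.
  move: Pw wb; rewrite -[in P w](iso_preserves Ag) => -[u Pu <-].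
  by rewrite gaE => ub; exists u => //; rewrite FE.
- exists (g *m x), (g *m y), (g *m z); split; [by exists x|by exists y|by exists z|].
  rewrite -!mulmxBr -mul_mx_row -xyz -mxrank_tr trmx_mul.
  by rewrite mxrankMfree ?mxrank_tr// row_free_unit unitmx_tr.
Qed.

Section Actions.
Variables (P : set 'cV[R]_3) (A : isometry_group P).

Definition iso_one : A := SigSub (mem_set (iso1 A)).

Definition iso_mul (g h : A) : A :=
  SigSub (mem_set (isoM (set_mem (valP g)) (set_mem (valP h)))).

Definition face_act (g : A) (F : faces P) : faces P :=
  SigSub (mem_set (face_move (set_mem (valP g)) (set_mem (valP F)))
          : move (val g) (val F) \in faces P).

Record tile_designs (T : finType) := TileDesigns {
  tile_act : A -> T * faces P -> T * faces P;
  tile_act1 : forall p, tile_act iso_one p = p;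
  tile_actM : forall (g h : A) p,
    tile_act (iso_mul g h) p = tile_act g (tile_act h p);
  tile_act_over : forall (g : A) p, (tile_act g p).2 = face_act g p.2 }.

Variables (T : finType) (D : tile_designs T).

Definition tiling : Type := faces P -> T.

(* The tiling tau' is g . tau. *)
Definition tiling_moved (g : A) (tau tau' : tiling) : Prop :=
  forall F : faces P,
    (tau' (face_act g F), face_act g F) = tile_act D g (tau F, F).

Definition tiling_orbit (tau : tiling) : set tiling :=
  [set tau' | exists g : A, tiling_moved g tau tau'].

Definition tiling_orbits : set (set tiling) :=
  [set tiling_orbit tau | tau in [set: tiling]].

(* For g in the stabilizer of F, this is the number t_g. *)
Definition num_fixed_designs (g : A) (F : faces P) : nat :=
  #|[pred t : T | `[< tile_act D g (t, F) = (t, F) >]]|.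

Definition stabilizes (g : A) (F : faces P) : Prop := face_act g F = F.

Definition fixes_points (g : A) (X : set 'cV[R]_3) : Prop :=
  forall x, X x -> val g *m x = x.

(* Meant for a set X with exactly two elements. *)
Definition swaps_points (g : A) (X : set 'cV[R]_3) : Prop :=
  forall x y, X x -> X y -> x <> y -> val g *m x = y.

(* Inside the plane of F, the half-turn about c is the point reflection in c. *)
Definition induces_half_turn (g : A) (F : faces P) : Prop :=
  stabilizes g F /\
  exists2 c, val F c & forall x, val F x -> val g *m x - c = - (x - c).

End Actions.

Definition signed_perm_mx (s : 'S_3) (e : {ffun 'I_3 -> bool}) : 'M[R]_3 :=
  \matrix_(i, j) ((-1) ^+ e i *+ (s i == j)).

Definition Oh_set : set 'M[R]_3 := [set g | exists s e, g = signed_perm_mx s e].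

Definition Oh_orbit (w : 'cV[R]_3) : set 'cV[R]_3 := [set g *m w | g in Oh_set].

Definition vtx : 'cV[R]_3 := delta_mx 0 0.
Definition vtx' : 'cV[R]_3 := const_mx 2^-1.

Definition rhombic_dodecahedron : set 'cV[R]_3 :=
  convex_hull (Oh_orbit vtx `|` Oh_orbit vtx').

Lemma signed_perm_mxM s e s' e' :
  signed_perm_mx s e *m signed_perm_mx s' e' =
  signed_perm_mx (s * s')%g [ffun i => e i (+) e' (s i)].
Proof.
apply/matrixP => i k; rewrite !mxE (bigD1 (s i))//= !mxE eqxx mulr1n big1 => [|j].
  by rewrite addr0 permM ffunE signr_addb mulrnAr.
by rewrite !mxE eq_sym => /negPf->; rewrite mulr0n mul0r.
Qed.

Lemma signed_perm_mx1 : signed_perm_mx 1%g [ffun=> false] = 1%:M.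
Proof. by apply/matrixP => i j; rewrite !mxE ffunE perm1 expr0. Qed.

Lemma signed_perm_mx_orthogonal s e :
  (signed_perm_mx s e)^T *m signed_perm_mx s e = 1%:M.
Proof.
apply/mulmx1C/matrixP => i k; rewrite !mxE (bigD1 (s i))//= !mxE eqxx big1 => [|j].
  rewrite addr0 mulr1n (inj_eq perm_inj) eq_sym.
  by case: eqVneq => [->|_]; rewrite ?mulr0// mulr1n -signr_addb addbb.
by rewrite !mxE eq_sym => /negPf->; rewrite mulr0n mul0r.
Qed.

Lemma signed_perm_mxV s e :
  invmx (signed_perm_mx s e) =
  signed_perm_mx s^-1%g [ffun i => e ((s^-1)%g i)].
Proof.
have [_ gU] := mulmx1_unit (signed_perm_mx_orthogonal s e).
apply: (can_inj (mulKmx gU)); rewrite mulmxV// signed_perm_mxM mulgV.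
rewrite -signed_perm_mx1; congr signed_perm_mx; apply/ffunP => i.
by rewrite !ffunE permK addbb.
Qed.

Lemma Oh_set1 : Oh_set 1%:M.
Proof. by exists 1%g, [ffun=> false]; rewrite signed_perm_mx1. Qed.

Lemma Oh_setM g h : Oh_set g -> Oh_set h -> Oh_set (g *m h).
Proof.
by move=> [s [e ->]] [s' [e' ->]]; rewrite signed_perm_mxM; do 2!eexists.
Qed.

Lemma Oh_setV g : Oh_set g -> Oh_set (invmx g).
Proof. by move=> [s [e ->]]; rewrite signed_perm_mxV; do 2!eexists. Qed.

Lemma Oh_orthogonal g : Oh_set g -> g^T *m g = 1%:M.
Proof. by move=> [s [e ->]]; exact: signed_perm_mx_orthogonal. Qed.

Lemma Oh_preserves_sub g : Oh_set g ->
  move g rhombic_dodecahedron `<=` rhombic_dodecahedron.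
Proof.
move=> Og _ [x Px <-] C [Cconv XC].
apply: (Px [set y | C (g *m y)]); split.
  move=> y z k /set_mem yC /set_mem zC; apply/mem_set.
  have := Cconv _ _ k (mem_set yC) (mem_set zC) => /set_mem.
  by rewrite /conv /= mulmxDr -!scalemxAr.
move=> y yX; apply: XC; case: yX => -[h Oh <-]; [left|right].
  by exists (g *m h); [exact: Oh_setM|rewrite mulmxA].
by exists (g *m h); [exact: Oh_setM|rewrite mulmxA].
Qed.

Lemma Oh_preserves g : Oh_set g ->
  move g rhombic_dodecahedron = rhombic_dodecahedron.
Proof.
move=> Og; apply/seteqP; split; first exact: Oh_preserves_sub.
have [_ gU] := mulmx1_unit (Oh_orthogonal Og).
move=> x Px; exists (invmx g *m x); last by rewrite mulKVmx.
by apply: (Oh_preserves_sub (Oh_setV Og)); exists x.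
Qed.

Definition Oh : isometry_group rhombic_dodecahedron :=
  IsometryGroup Oh_orthogonal Oh_preserves Oh_set1 Oh_setM Oh_setV.

(* The endpoints of the long and of the short diagonal of F, respectively. *)
Definition long_ends (F : faces rhombic_dodecahedron) : set 'cV[R]_3 :=
  val F `&` Oh_orbit vtx.
Definition short_ends (F : faces rhombic_dodecahedron) : set 'cV[R]_3 :=
  val F `&` Oh_orbit vtx'.

Definition induces_f (g : Oh) (F : faces rhombic_dodecahedron) : Prop :=
  [/\ stabilizes g F, swaps_points g (short_ends F) &
      fixes_points g (long_ends F)].

Definition induces_rf (g : Oh) (F : faces rhombic_dodecahedron) : Prop :=
  [/\ stabilizes g F, swaps_points g (long_ends F) &
      fixes_points g (short_ends F)].

End Polyhedra.

Arguments rhombic_dodecahedron R : clear implicits.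

(* Main.v *)
Require Import Defs.
From HB Require Import structures.
From mathcomp Require Import all_boot all_order all_fingroup all_algebra.
From mathcomp Require Import finmap.
From mathcomp Require Import boolp classical_sets functions cardinality reals.
From mathcomp Require Import interval_inference convex.
From mathcomp Require Import ring lra.

Set Implicit Arguments.
Unset Strict Implicit.
Unset Printing Implicit Defensive.

Import Order.TTheory GRing.Theory Num.Theory.


(** The count is Burnside's lemma, once two facts are known about a group
    element g acting on the twelve faces.

    First, a tiling is a section of the projection from designs-on-faces to
    faces, and it is fixed by g exactly when it is invariant as a section.  On
    a cycle of faces of length m, such a section is determined by its value at
    one face, and that value can be any design fixed by g ^ m
    ([card_invariant_sections]).

    Second, in the octahedral group every power of g that fixes some face not
    fixed by g is the identity: the cycles of g on faces have length 1 or #[g]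
    ([order_normal_act]).  A long cycle therefore contributes a free choice
    among all designs, and a fixed face contributes the designs fixed by g
    there.  The stabilizer of a face is the Klein group {1, r, f, rf}, and
    which of the four types a non-identity element has at a face that it fixes
    can be read off g alone: type f when g is diagonal, and otherwise r or rf
    according to the parity of the number of minus signs ([kind]).  So g
    contributes t_id ^ ((12 - n) / #[g]) * t_kind(g) ^ n, where n is the number
    of faces fixed by g ([card_tilings_fixed]), and the sum over the 48 signed
    permutations is the stated polynomial ([card_tiling_orbits]).

    The combinatorics takes place in a finite model: signed permutations
    acting on the twelve outer normals, the vectors with entries in {0, 1, -1}
    and exactly one zero.  Geometry enters to identify the faces with these
    normals ([is_faceP], [is_face_set], [face_set_inj]).  A linear form can be
    moved by a signed permutation into the chamber a0 >= a1 >= a2 >= 0; in this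
    chamber the set where it is maximal on the solid is contained in a line
    unless a is proportional to (1, 1, 0) ([support_dominant]).  In particular
    all faces are images of the face with normal (1, 1, 0). *)

(** * Sections invariant under a permutation of the base *)

Lemma iter_modn (U : Type) (h : U -> U) n u k :
  iter n h u = u -> iter k h u = iter (k %% n) h u.
Proof.
move=> hu; rewrite [in LHS](divn_eq k n) addnC iterD iterM; congr iter.
by rewrite iter_fix.
Qed.

Section InvariantSections.
Variables (X T : finType) (f : X -> X) (a : T * X -> T * X).
Hypotheses (injf : injective f) (a_over : forall p, (a p).2 = f p.2).

Definition invariant_sections : {set {ffun X -> T}} :=
  [set tau : {ffun X -> T} | [forall x, a (tau x, x) == (tau (f x), f x)]].

(** The values at x which come back to themselves after one turn around the
    cycle of x. *)
Definition holonomy_fixed (x : X) : {set T} :=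
  [set c | iter (fingraph.order f x) a (c, x) == (c, x)].

Lemma iter_invariant_section tau k x : tau \in invariant_sections ->
  iter k a (tau x, x) = (tau (iter k f x), iter k f x).
Proof.
rewrite inE => /forallP/= inv; elim: k => //= k ->; exact/eqP/inv.
Qed.

Lemma iter_findex_froot y : iter (findex f (froot f y) y) f (froot f y) = y.
Proof. by rewrite iter_findex// fconnect_sym// connect_root. Qed.

(** An invariant section is freely determined by its values at one root per
    cycle; the only constraint on such a value is that its transport around
    the whole cycle is the identity. *)
Lemma card_invariant_sections :
  #|invariant_sections| = (\prod_(x in froots f) #|holonomy_fixed x|)%N.
Proof.
pose rt := {x in froots f}; pose mkrt x rx : rt := exist _ x rx.
pose res (tau : {ffun X -> T}) : {ffun rt -> T} := [ffun u => tau (val u)].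
pose holo (u : rt) : {pred T} := [pred c in holonomy_fixed (val u)].
have <- : #|(family holo : simpl_pred {ffun rt -> T})|
    = (\prod_(x in froots f) #|holonomy_fixed x|)%N.
  by rewrite card_family foldrE big_map big_enum/= [RHS]big_sub.
have res_inj : {in invariant_sections &, injective res}.
  move=> tau tau' tauI tauI' /ffunP eq_res; apply/ffunP => y.
  have ry : froot f y \in froots f.
    by rewrite inE roots_root//; exact: fconnect_sym.
  have := eq_res (mkrt _ ry); rewrite !ffunE/= => eqr.
  have := iter_invariant_section (findex f (froot f y) y) (froot f y) tauI.
  rewrite eqr (iter_invariant_section _ _ tauI') iter_findex_froot.
  by case.
rewrite -(card_in_imset res_inj); apply: eq_card => sigma.
apply/imsetP/familyP => [[tau tauI ->] u|sigmaP].
  by rewrite ffunE !inE (iter_invariant_section _ _ tauI) iter_order.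
have rP y : froot f y \in froots f.
  by rewrite inE roots_root//; exact: fconnect_sym.
(* The section extending sigma transports the value at the root of y to y. *)
pose tau : {ffun X -> T} := [ffun y =>
  (iter (findex f (froot f y) y) a (sigma (mkrt _ (rP y)), froot f y)).1].
have a2 k p : (iter k a p).2 = iter k f p.2.
  by elim: k => //= k <-; rewrite a_over.
have tauE (u : rt) k :
    iter k a (sigma u, val u) = (tau (iter k f (val u)), iter k f (val u)).
  set y := iter k f (val u).
  have uy : froot f y = val u.
    have /eqP <- : froot f (val u) == val u by have := valP u; rewrite inE.
    by apply/esym/fingraph.rootP; [exact: fconnect_sym|exact: fconnect_iter].
  have su : (mkrt _ (rP y)) = u by apply: val_inj.
  have holo_u :
      iter (fingraph.order f (val u)) a (sigma u, val u) = (sigma u, val u).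
    by apply/eqP; have := sigmaP u; rewrite !inE.
  rewrite [RHS]surjective_pairing [LHS]surjective_pairing a2/= ffunE su uy.
  congr ((_ : T), _).
  have -> : y = iter (k %% fingraph.order f (val u)) f (val u).
    by apply: iter_modn; rewrite iter_order.
  by rewrite findex_iter ?ltn_mod ?fingraph.order_gt0// (iter_modn k holo_u).
exists tau; last first.
  by apply/ffunP => u; rewrite ffunE; have [] := tauE u 0%N.
rewrite inE; apply/forallP => y /=; apply/eqP.
(* Applying [a] at y is one more transport step from the root of y. *)
have := tauE (mkrt _ (rP y)) (findex f (froot f y) y).+1.
by rewrite iterS tauE/= iter_findex_froot.
Qed.

End InvariantSections.
(** * The group of signed permutations and the twelve normals *)

(** The product is chosen so that [signed_perm_mx] is multiplicative. *)
Definition signed_perm : Type := ('S_3 * {ffun 'I_3 -> bool})%type.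

HB.instance Definition _ := Finite.on signed_perm.

Definition sp_mul (g h : signed_perm) : signed_perm :=
  ((g.1 * h.1)%g, [ffun i => g.2 i (+) h.2 (g.1 i)]).
Definition sp_one : signed_perm := (1%g, [ffun=> false]).
Definition sp_inv (g : signed_perm) : signed_perm :=
  (g.1^-1%g, [ffun i => g.2 (g.1^-1%g i)]).

Fact sp_mulA : associative sp_mul.
Proof.
move=> g h k; congr (_, _); first by rewrite /= mulgA.
by apply/ffunP => i; rewrite !ffunE/= permM addbA.
Qed.

Fact sp_mul1 : left_id sp_one sp_mul.
Proof.
move=> [s e]; congr (_, _); first by rewrite /= mul1g.
by apply/ffunP => i; rewrite !ffunE/= perm1.
Qed.

Fact sp_mulV : left_inverse sp_one sp_inv sp_mul.
Proof.
move=> [s e]; congr (_, _); first by rewrite /= mulVg.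
by apply/ffunP => i; rewrite !ffunE/= addbb.
Qed.

HB.instance Definition _ :=
  Finite_isGroup.Build signed_perm sp_mulA sp_mul1 sp_mulV.

Definition i0 : 'I_3 := @Ordinal 3 0 isT.
Definition i1 : 'I_3 := @Ordinal 3 1 isT.
Definition i2 : 'I_3 := @Ordinal 3 2 isT.

Lemma forall_I3 (Q : 'I_3 -> Prop) : Q i0 -> Q i1 -> Q i2 -> forall i, Q i.
Proof.
move=> Q0 Q1 Q2 [[|[|[|//]]] i3].
- by rewrite (_ : Ordinal i3 = i0)//; exact: val_inj.
- by rewrite (_ : Ordinal i3 = i1)//; exact: val_inj.
- by rewrite (_ : Ordinal i3 = i2)//; exact: val_inj.
Qed.

(** Vectors with entries in {0, 1, -1}: [None] is 0, [Some b] is (-1) ^ b. *)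
Definition trits := {ffun 'I_3 -> option bool}.

Definition listing (U : Type) (x : 'I_3 -> U) : seq U := [:: x i0; x i1; x i2].

Lemma listing_inj (U : Type) (x y : 'I_3 -> U) : listing x = listing y -> x =1 y.
Proof. by case=> e0 e1 e2; apply: forall_I3. Qed.

(** The outer normals of the rhombic dodecahedron: the vectors such as
    (1, 1, 0), with exactly one zero entry. *)
Definition is_normal (x : trits) : bool := count_mem None (listing x) == 1%N.

Definition normal : Type := {x : trits | is_normal x}.

HB.instance Definition _ := Finite.on normal.
HB.instance Definition _ := SubType.on normal.

Definition to_normal (x : trits) (nx : is_normal x) : normal := exist _ x nx.

Definition trits_act (g : signed_perm) (x : trits) : trits :=
  [ffun i => omap (addb (g.2 i)) (x (g.1 i))].

(** * Verification of finite facts on lists *)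

(** Finite facts about the group and the normals are established by running
    through explicit lists.  Row i of a signed permutation matrix is recorded
    as the column of its nonzero entry and whether this entry is -1. *)
Definition sp_code := seq (nat * bool).

Definition code (g : signed_perm) : sp_code :=
  listing (fun i => (val (g.1 i), g.2 i)).

Definition code_mul (c d : sp_code) : sp_code :=
  [seq let q := nth (0%N, false) d p.1 in (q.1, p.2 (+) q.2) | p <- c].

Definition code_act (c : sp_code) (n : seq (option bool)) : seq (option bool) :=
  [seq omap (addb p.2) (nth None n p.1) | p <- c].

(** The four elements which preserve the face x0 + x1 = 1, as lists: the
    identity, the half-turn, the reflection x2 -> - x2, which swaps the ends of
    the short diagonal, and the exchange of x0 and x1, which swaps the ends of
    the long one. *)
Definition code_one : sp_code := [:: (0, false); (1, false); (2, false)]%N.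
Definition code_r : sp_code := [:: (1, false); (0, false); (2, true)]%N.
Definition code_f : sp_code := [:: (0, false); (1, false); (2, true)]%N.
Definition code_rf : sp_code := [:: (1, false); (0, false); (2, false)]%N.

Definition words3 (U : eqType) (l : seq U) : seq (seq U) :=
  [seq a :: w | a <- l, w <- [seq [:: b; c] | b <- l, c <- l]].

Lemma mem_words3 (U : eqType) (l : seq U) (x : 'I_3 -> U) :
  (forall i, x i \in l) -> listing x \in words3 l.
Proof. by move=> xl; do 2?[apply: allpairs_f => //]. Qed.

Definition all_codes : seq sp_code :=
  [seq zip p e | p <- [seq p <- words3 [:: 0; 1; 2]%N | uniq p],
                 e <- words3 [:: false; true]].

Definition all_normals : seq (seq (option bool)) :=
  [seq n <- words3 [:: None; Some false; Some true] | count_mem None n == 1%N].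

Lemma code_inj : injective code.
Proof.
move=> [s e] [s' e'] /listing_inj eq_c; congr (_, _).
  by apply/permP => i; apply/val_inj; case: (eq_c i).
by apply/ffunP => i; case: (eq_c i).
Qed.

Lemma code_all g : code g \in all_codes.
Proof.
have -> : code g = zip (listing (val \o g.1)) (listing g.2) by [].
apply: allpairs_f; last by apply: mem_words3 => i; case: (g.2 i).
rewrite mem_filter; apply/andP; split.
  by rewrite /= !inE !(inj_eq val_inj) !(inj_eq perm_inj).
by apply: mem_words3 => i /=; case: (g.1 i) => -[|[|[|]]].
Qed.

Lemma nth_code g (i : 'I_3) : nth (0%N, false) (code g) i = (val (g.1 i), g.2 i).
Proof. by move: i; apply: forall_I3. Qed.

Lemma nth_listing (U : Type) u0 (x : 'I_3 -> U) (i : 'I_3) :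
  nth u0 (listing x) i = x i.
Proof. by move: i; apply: forall_I3. Qed.

Lemma codeM g h : code (g * h)%g = code_mul (code g) (code h).
Proof.
by rewrite /code/= /code_mul /= -/(code h) !nth_code /listing /= !ffunE !permM.
Qed.

Lemma listing_act g x : listing (trits_act g x) = code_act (code g) (listing x).
Proof. by rewrite /code_act/= -/(listing x) !nth_listing /listing !ffunE. Qed.

Lemma code1 : code 1%g = code_one.
Proof. by rewrite /code /listing/= !perm1 !ffunE. Qed.

(** Sums over the group become sums over an explicit list. *)
Lemma perm_codes : perm_eq [seq code g | g : signed_perm] all_codes.
Proof.
have sub : {subset [seq code g | g : signed_perm] <= all_codes}.
  by move=> _ /fintype.imageP[g _ ->]; exact: code_all.
have uniq_c : uniq [seq code g | g : signed_perm].
  by rewrite map_inj_uniq ?enum_uniq//; exact: code_inj.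
have sz : size [seq code g | g : signed_perm] = 48.
  by rewrite size_map -cardT card_prod card_Sn card_ffun card_bool card_ord.
have szle : (size all_codes <= size [seq code g | g : signed_perm])%N by rewrite sz.
have [_ eq_c] := uniq_min_size uniq_c sub szle.
by apply: uniq_perm => //; vm_compute.
Qed.

Lemma normal_all (x : normal) : listing (val x) \in all_normals.
Proof.
rewrite mem_filter [count_mem _ _ == _](valP x); apply: mem_words3 => i.
by case: (val x i) => [[]|].
Qed.

Lemma perm_normals : perm_eq [seq listing (val x) | x : normal] all_normals.
Proof.
apply: uniq_perm => [||n]; first 1 last.
- by vm_compute.
- apply/fintype.imageP/idP => [[x _ ->]|]; first exact: normal_all.
  rewrite mem_filter => /andP[n1 /allpairsP[[a w] [_ wP n3]]].
  move: wP n3 => /allpairsP[[b c] [_ _ /= ->]] n3.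
  have nE : listing [ffun i : 'I_3 => nth None n i] = n by rewrite /listing !ffunE n3.
  have nN : is_normal [ffun i : 'I_3 => nth None n i] by rewrite /is_normal nE.
  by exists (to_normal nN).
- rewrite map_inj_uniq ?enum_uniq// => x y exy.
  by apply/val_inj/ffunP; exact: listing_inj.
Qed.

Lemma all_codesP (P : pred sp_code) : all P all_codes -> forall g, P (code g).
Proof. by move=> /allP PP g; apply/PP/code_all. Qed.

Lemma all_normalsP (P : pred (seq (option bool))) :
  all P all_normals -> forall x : normal, P (listing (val x)).
Proof. by move=> /allP PP g; apply/PP/normal_all. Qed.

Lemma trits_act_normal g (x : normal) : is_normal (trits_act g (val x)).
Proof.
rewrite /is_normal listing_act.
have check : all (fun c => all (fun n =>
    count_mem None (code_act c n) == 1%N) all_normals) all_codes by vm_compute.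
exact: all_normalsP (all_codesP check g) x.
Qed.

Definition normal_act g (x : normal) : normal := to_normal (trits_act_normal g x).

Lemma listing_normal_inj : injective (fun x : normal => listing (val x)).
Proof. by move=> x y exy; apply/val_inj/ffunP; exact: listing_inj. Qed.

Lemma normal_act1 x : normal_act 1%g x = x.
Proof.
apply/val_inj/ffunP => i; rewrite !ffunE perm1.
by case: (val x i).
Qed.

Lemma normal_actM g h x : normal_act (g * h)%g x = normal_act g (normal_act h x).
Proof.
apply/val_inj/ffunP => i; rewrite !ffunE permM/=.
by case: (val x _) => //= b; rewrite addbA.
Qed.

Lemma normal_act_inj g : injective (normal_act g).
Proof.
apply: (can_inj (g := normal_act g^-1%g)) => x.
by rewrite -normal_actM mulVg normal_act1.
Qed.

(** * Cycles on the normals and stabilizers *)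

(** The order of a group element; the orders 1, 2, 3, 4 and 6 of octahedral
    symmetries are all below the search bound. *)
Definition code_order (c : sp_code) : nat :=
  (find (fun k => iter k.+1 (code_mul c) code_one == code_one) (iota 0 6)).+1.

Definition code_fixed (c : sp_code) : nat :=
  count (fun n => code_act c n == n) all_normals.

Lemma code_exp g k : code (g ^+ k)%g = iter k (code_mul (code g)) code_one.
Proof. by elim: k => [|k IH]; rewrite ?expg0 ?code1// expgS codeM IH. Qed.

(** The element of the stabilizer of the base face to which [c] is conjugate,
    whenever [c] fixes a face.  Both criteria are invariant under conjugation:
    the underlying permutation and the parity of the number of signs define
    homomorphisms to 'S_3 and to Z/2. *)
Definition code_kind (c : sp_code) : sp_code :=
  if c == code_one then code_one
  else if unzip1 c == [:: 0; 1; 2]%N then code_f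
  else if odd (count id (unzip2 c)) then code_r
  else code_rf.

Definition base_normal_list : seq (option bool) := [:: Some false; Some false; None].

Fact base_normal_subproof : is_normal [ffun i : 'I_3 => nth None base_normal_list i].
Proof. by rewrite /is_normal /listing !ffunE. Qed.

Definition base_normal : normal := to_normal base_normal_subproof.

Lemma listing_base : listing (val base_normal) = base_normal_list.
Proof. by rewrite /listing !ffunE. Qed.

Lemma normal_act_trans x : exists h, normal_act h base_normal = x.
Proof.
have check : all (fun n =>
    has (fun c => code_act c base_normal_list == n) all_codes) all_normals.
  by vm_compute.
have /hasP[c] := all_normalsP check x.
rewrite -(perm_mem perm_codes) => /fintype.imageP[h _ ->] /eqP hx.
by exists h; apply: listing_normal_inj; rewrite listing_act listing_base.
Qed.

(** If g fixes the face h . F0, then h^-1 g h stabilizes F0, and it is the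
    stabilizer element of the kind of g. *)
Lemma conj_code_kind g h :
  normal_act g (normal_act h base_normal) = normal_act h base_normal ->
  code_mul (code g) (code h) = code_mul (code h) (code_kind (code g)).
Proof.
move=> /(f_equal (fun x : normal => listing (val x))).
rewrite !listing_act listing_base => /eqP gh; apply/eqP; move: gh; apply/implyP.
have check : all (fun c => all (fun d =>
    (code_act c (code_act d base_normal_list) == code_act d base_normal_list)
    ==> (code_mul c d == code_mul d (code_kind c))) all_codes) all_codes.
  by vm_compute.
exact: all_codesP (all_codesP check g) h.
Qed.
Definition flip3 : {ffun 'I_3 -> bool} := [ffun i => i == i2].
Definition base_r : signed_perm := (tperm i0 i1, flip3).
Definition base_f : signed_perm := (1%g, flip3).
Definition base_rf : signed_perm := (tperm i0 i1, [ffun=> false]).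

Lemma code_base_r : code base_r = code_r.
Proof. by rewrite /code /listing /= tpermL tpermR tpermD// !ffunE. Qed.
Lemma code_base_f : code base_f = code_f.
Proof. by rewrite /code /listing /= !perm1 !ffunE. Qed.
Lemma code_base_rf : code base_rf = code_rf.
Proof. by rewrite /code /listing /= tpermL tpermR tpermD// !ffunE. Qed.

Definition kind (g : signed_perm) : signed_perm :=
  if code g == code_one then 1%g
  else if unzip1 (code g) == [:: 0; 1; 2]%N then base_f
  else if odd (count id (unzip2 (code g))) then base_r
  else base_rf.

Lemma code_kindE g : code (kind g) = code_kind (code g).
Proof.
by rewrite /kind !(fun_if code) code1 code_base_r code_base_f code_base_rf.
Qed.

Lemma stab_kind g h :
  normal_act g (normal_act h base_normal) = normal_act h base_normal ->
  (g * h = h * kind g)%g.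
Proof. by move=> /conj_code_kind gh; apply: code_inj; rewrite !codeM code_kindE. Qed.

Lemma card_fixed_normals g :
  #|[pred x | normal_act g x == x]| = code_fixed (code g).
Proof.
rewrite /code_fixed -sum1_count -(perm_big _ perm_normals) big_map big_enum_cond.
rewrite -sum1_card; apply: eq_bigl => x.
by rewrite !inE -(inj_eq listing_normal_inj) listing_act.
Qed.

Lemma card_normal : #|{: normal}| = 12%N.
Proof. by rewrite cardT -(size_map (fun x : normal => listing (val x)))
  (perm_size perm_normals). Qed.

Lemma iter_normal_act g k x : iter k (normal_act g) x = normal_act (g ^+ k)%g x.
Proof.
by elim: k => [|k IH]; rewrite ?expg0 ?normal_act1// expgS normal_actM -IH.
Qed.

Lemma expg_code_order g : (g ^+ code_order (code g) = 1)%g.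
Proof.
apply: code_inj; rewrite code_exp code1; apply/eqP.
have check : all (fun c =>
    iter (code_order c) (code_mul c) code_one == code_one) all_codes.
  by vm_compute.
exact: all_codesP check g.
Qed.

(** No nontrivial power of a signed permutation g fixes a face that g
    moves.  (A quarter turn, for instance, squares to a half-turn about a
    coordinate axis, which fixes no face, rather than to one about the centre
    of a face.) *)
Lemma order_normal_act g x : normal_act g x != x ->
  fingraph.order (normal_act g) x = code_order (code g).
Proof.
move=> gx; set f := normal_act g; set d := code_order _.
have fd : iter d f x = x.
  by rewrite iter_normal_act expg_code_order normal_act1.
have check : all (fun c => all (fun n => (code_act c n == n) ||
   all (fun k => iter k (code_act c) n != n) (iota 1 (code_order c).-1))
   all_normals) all_codes by vm_compute.
have iterE k : listing (val (iter k f x)) =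
     iter k (code_act (code g)) (listing (val x)).
  by elim: k => //= k <-; rewrite listing_act.
have free k : (0 < k < d)%N -> iter k f x != x.
  move=> /andP[k0 kd]; have /orP[] := all_normalsP (all_codesP check g) x.
    rewrite -(listing_act g (val x)).
    by rewrite (inj_eq listing_normal_inj (normal_act g x)) (negPf gx).
  move=> /allP/(_ k); rewrite -iterE (inj_eq listing_normal_inj); apply.
  by rewrite mem_iota k0.
apply/eqP; rewrite eqn_leq; apply/andP; split; rewrite leqNgt; apply/negP => lt_d.
  by have := findex_iter lt_d; rewrite fd findex0.
have := free (fingraph.order f x).
rewrite iter_order ?eqxx; last exact: normal_act_inj.
by rewrite fingraph.order_gt0 lt_d => /(_ isT).
Qed.

Lemma order_fixpoint (X : finType) (f : X -> X) x :
  f x = x -> fingraph.order f x = 1%N.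
Proof.
move=> fx; apply/eqP; rewrite eqn_leq fingraph.order_gt0 andbT leqNgt.
by apply/negP => /findex_iter; rewrite /= fx findex0.
Qed.

(** * Burnside counting of tilings in the finite model *)

Section TileDesigns.
Variables (T : finType) (a : signed_perm -> T * normal -> T * normal).
Hypotheses (a1 : forall p, a 1%g p = p)
  (aM : forall g h p, a (g * h)%g p = a g (a h p))
  (a_over : forall g p, (a g p).2 = normal_act g p.2).

Definition fixed_designs g x : {set T} := [set c | a g (c, x) == (c, x)].

(** Transport from the base face by h matches designs fixed by h^-1 g h with
    designs fixed by g. *)
Lemma card_fixed_designs g x : normal_act g x = x ->
  #|fixed_designs g x| = #|fixed_designs (kind g) base_normal|.
Proof.
have [h <-] := normal_act_trans x => /stab_kind gh.
pose phi c := (a h (c, base_normal)).1.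
pose psi c := (a h^-1%g (c, normal_act h base_normal)).1.
have phiE c : a h (c, base_normal) = (phi c, normal_act h base_normal).
  by rewrite [LHS]surjective_pairing a_over.
have psiE c : a h^-1%g (c, normal_act h base_normal) = (psi c, base_normal).
  by rewrite [LHS]surjective_pairing a_over/= -normal_actM mulVg normal_act1.
have phiK : cancel phi psi.
  by move=> c; rewrite /psi -phiE -aM mulVg a1.
have psiK : cancel psi phi.
  by move=> c; rewrite /phi -psiE -aM mulgV a1.
have -> : fixed_designs (kind g) base_normal
    = phi @^-1: fixed_designs g (normal_act h base_normal).
  apply/setP => c; rewrite !inE -phiE -aM gh aM.
  by rewrite (can_eq (g := a h^-1%g))// => p; rewrite -aM mulVg a1.
by rewrite on_card_preimset//; apply: onW_bij; exists psi.
Qed.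

(** A cycle of length #[g] leaves the choice of design free because
    g ^ #[g] = 1; all other cycles are fixed faces. *)
Lemma card_tilings_fixed g :
  #|invariant_sections (normal_act g) (a g)| =
  (#|T| ^ ((12 - code_fixed (code g)) %/ code_order (code g)) *
   #|fixed_designs (kind g) base_normal| ^ code_fixed (code g))%N.
Proof.
have injg := @normal_act_inj g.
have iter_a k p : iter k (a g) p = a (g ^+ k)%g p.
  by elim: k => [|k IH]; rewrite ?expg0 ?a1// expgS aM -IH.
rewrite (card_invariant_sections injg (a_over g)).
rewrite (bigID [pred x | normal_act g x == x])/= mulnC; congr (_ * _)%N.
  rewrite (eq_bigr (fun=> #|T|)) => [|x /andP[_ gx]]; last first.
    rewrite /holonomy_fixed order_normal_act//; apply: eq_card => c.
    by rewrite inE iter_a expg_code_order a1 eqxx.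
  rewrite prod_nat_const; congr (_ ^ _)%N.
  have oP : [predC [pred x | normal_act g x == x]]
      \subset order_set (normal_act g) (code_order (code g)).
    by apply/fintype.subsetP => x; rewrite !inE => gx; rewrite order_normal_act.
  have cP : fclosed (normal_act g) [predC [pred x | normal_act g x == x]].
    by move=> x _ /eqP <-; rewrite !inE (inj_eq injg).
  have := fcard_order_set injg oP cP.
  have := cardC [pred x | normal_act g x == x].
  rewrite card_fixed_normals card_normal => <-; rewrite addKn => <-.
  rewrite mulnK//; exact: eq_card.
rewrite (eq_bigl [pred x | normal_act g x == x]) => [|x]; last first.
  rewrite /= andb_idl// => /eqP gx; rewrite inE.
  have := connect_root (frel (normal_act g)) x.
  move=> /iter_findex; rewrite iter_fix// => xr.
  by rewrite /roots -xr eqxx.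
rewrite (eq_bigr (fun=> #|fixed_designs (kind g) base_normal|)) => [|x /eqP gx].
  by rewrite prod_nat_const card_fixed_normals.
rewrite -(card_fixed_designs gx) /holonomy_fixed /fixed_designs.
by rewrite order_fixpoint.
Qed.

(** Actions of finite groups are right actions, hence the inverse. *)
Definition tiling_act (tau : {ffun normal -> T}) g : {ffun normal -> T} :=
  [ffun x => (a g^-1%g (tau (normal_act g x), normal_act g x)).1].

Lemma tiling_actE tau g x :
  a g (tiling_act tau g x, x) = (tau (normal_act g x), normal_act g x).
Proof.
rewrite ffunE; set p := (tau _, _).
have -> : ((a g^-1%g p).1, x) = a g^-1%g p.
  by rewrite [RHS]surjective_pairing a_over/= -normal_actM mulVg normal_act1.
by rewrite -aM mulgV a1.
Qed.

Lemma tiling_act_eq (tau tau' : {ffun normal -> T}) g :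
  (forall x, a g (tau' x, x) = (tau (normal_act g x), normal_act g x)) ->
  tiling_act tau g = tau'.
Proof.
move=> tau'E; apply/ffunP => x; have := tiling_actE tau g x; rewrite -tau'E.
by move=> /(f_equal (a g^-1%g)); rewrite -!aM mulVg !a1 => -[].
Qed.

Fact tiling_act_is_action : is_action [set: signed_perm] tiling_act.
Proof.
split=> [g tau tau' eq_tau|tau g h _ _]; last first.
  by apply: tiling_act_eq => x; rewrite aM !tiling_actE normal_actM.
apply/ffunP => x; rewrite -[x](normal_act1) -(mulgV g) normal_actM.
have := tiling_actE tau g (normal_act g^-1%g x).
by rewrite eq_tau tiling_actE => -[].
Qed.

Canonical tiling_action := Action tiling_act_is_action.

Lemma fix_tilings g :
  'Fix_tiling_action[g]%g = invariant_sections (normal_act g) (a g).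
Proof.
apply/setP => tau; rewrite [RHS]inE; apply/afix1P/forallP => [tau_fix x|inv].
  by rewrite -{1}tau_fix tiling_actE.
by apply: tiling_act_eq => x; apply/eqP/inv.
Qed.

(** The exponents of a summand: the second component is the number of cycles
    of length #[g], the third the number of fixed faces. *)
Definition cycle_data (c : sp_code) : nat * nat * nat :=
  (index (code_kind c) [:: code_one; code_r; code_f; code_rf],
   (12 - code_fixed c) %/ code_order c, code_fixed c)%N.

Lemma card_tiling_orbits :
  let t := #|T| in
  let t_r := #|fixed_designs base_r base_normal| in
  let t_f := #|fixed_designs base_f base_normal| in
  let t_rf := #|fixed_designs base_rf base_normal| in
  (#|orbit tiling_action [set: signed_perm] @: [set: {ffun normal -> T}]| * 48 =
   t ^ 12 + 4 * t ^ 6 + 8 * t ^ 4 + 12 * t ^ 3 + 8 * t ^ 2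
   + 6 * t ^ 5 * t_r ^ 2 + 3 * t ^ 4 * t_f ^ 4 + 6 * t ^ 5 * t_rf ^ 2)%N.
Proof.
move=> t t_r t_f t_rf.
have card_sp : #|[set: signed_perm]| = 48%N.
  by rewrite cardsT card_prod card_Sn card_ffun card_bool card_ord.
have acts : [acts [set: signed_perm], on [set: {ffun normal -> T}] | tiling_action].
  by apply/actsP => g _ tau; rewrite !inE.
rewrite -[X in (_ * X)%N = _]card_sp -(Frobenius_Cauchy acts).
pose weight (p : nat * nat * nat) :=
  (t ^ p.1.2 * nth 0 [:: t; t_r; t_f; t_rf] p.1.1 ^ p.2)%N.
have weightE g : #|'Fix_([set: {ffun normal -> T}] | tiling_action)[g]%g|
    = weight (cycle_data (code g)).
  rewrite finset.setTI fix_tilings card_tilings_fixed /weight/=; congr (_ * _ ^ _)%N.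
  rewrite -code_kindE /kind; case: ifP => _; first rewrite code1/=.
    rewrite /t -cardsT; congr #|pred_of_set _|; apply/setP => c.
    by rewrite !inE a1 eqxx.
  case: ifP => _; first by rewrite code_base_f.
  by case: ifP => _; rewrite ?code_base_r ?code_base_rf.
rewrite (eq_bigr _ (fun g _ => weightE g)).
rewrite (eq_bigl (fun g => g \in {: signed_perm})) => [|g]; last by rewrite !inE.
rewrite -big_enum -(big_map code xpredT (fun c => weight (cycle_data c))).
rewrite (perm_big _ perm_codes)/= -(big_map cycle_data xpredT weight).
set l := map _ _; vm_compute in l; rewrite /l unlock /weight /=.
ring.
Qed.

End TileDesigns.

(** * Geometry of the rhombic dodecahedron *)

Local Open Scope classical_set_scope.
Local Open Scope ring_scope.

Section Faces.
Variable R : realType.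
Local Notation P := (rhombic_dodecahedron R).
Implicit Types (y u v a : 'cV[R]_3) (g h : signed_perm) (x : normal).

Definition mx (g : signed_perm) : 'M[R]_3 := signed_perm_mx R g.1 g.2.

Definition vec (x : trits) : 'cV[R]_3 :=
  \col_i (if x i is Some b then (-1) ^+ b else 0).

Definition dot u v : R := (u^T *m v) 0 0.

Lemma dotE u v : dot u v = u i0 0 * v i0 0 + u i1 0 * v i1 0 + u i2 0 * v i2 0.
Proof.
rewrite /dot !mxE !big_ord_recl big_ord0 addr0 !mxE addrA.
by congr (_ * _ + _ * _ + _ * _); congr (_ _ _); apply: val_inj.
Qed.

Lemma mxM g h : mx (g * h)%g = mx g *m mx h.
Proof. by rewrite /mx signed_perm_mxM. Qed.

Lemma mx1 : mx 1%g = 1%:M. Proof. exact: signed_perm_mx1. Qed.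

Lemma mxK g y : mx g^-1%g *m (mx g *m y) = y.
Proof. by rewrite mulmxA -mxM mulVg mx1 mul1mx. Qed.

Lemma mx_act g y i : (mx g *m y) i 0 = (-1) ^+ g.2 i * y (g.1 i) 0.
Proof.
rewrite !mxE (bigD1 (g.1 i))//= !mxE eqxx mulr1n big1 ?addr0// => j.
by rewrite !mxE eq_sym => /negPf ->; rewrite mulr0n mul0r.
Qed.

Lemma mx_vec g x : mx g *m vec (val x) = vec (val (normal_act g x)).
Proof.
apply/colP => i; rewrite mx_act !mxE ffunE.
by case: (val x _) => [b|] /=; rewrite ?mulr0// signr_addb.
Qed.

Lemma dot_mx g u v : dot (mx g *m u) (mx g *m v) = dot u v.
Proof.
by rewrite /dot trmx_mul -mulmxA (mulmxA (mx g)^T) signed_perm_mx_orthogonal mul1mx.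
Qed.

Lemma Oh_mx g : Oh_set (mx g). Proof. by exists g.1, g.2. Qed.

Lemma P_mx g y : P (mx g *m y) <-> P y.
Proof.
have sub h z : P z -> P (mx h *m z).
  by move=> Pz; apply: (Oh_preserves_sub (Oh_mx h)); exists z.
by split=> [/(sub g^-1%g)|/sub//]; rewrite mxK.
Qed.

Lemma P_vtx : P (vtx R).
Proof. by move=> C [_]; apply; left; exists 1%:M; [exact: Oh_set1|rewrite mul1mx]. Qed.

Lemma P_vtx' : P (vtx' R).
Proof. by move=> C [_]; apply; right; exists 1%:M; [exact: Oh_set1|rewrite mul1mx]. Qed.

(** The inequalities |y_i| + |y_j| <= 1 cut out a convex set that is invariant under signed
    permutations, so it suffices to check them at one vertex of each type. *)
Lemma P_abs y i j : P y -> i != j -> `|y i 0| + `|y j 0| <= 1.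
Proof.
move=> Py; move: i j.
apply: (Py [set y | forall i j, i != j -> `|y i 0| + `|y j 0| <= 1]); split.
  move=> u v k /set_mem uC /set_mem vC; apply/mem_set => i j ij.
  have := uC i j ij; have := vC i j ij; rewrite /conv/= !mxE.
  have k0 : 0 <= k%:num by []. have k1 : k%:num <= 1 by [].
  set ui := u i 0; set uj := u j 0; set vi := v i 0; set vj := v j 0 => vle ule.
  have tri (p q : R) : `|k%:num * p + (1 - k%:num) * q|
      <= k%:num * `|p| + (1 - k%:num) * `|q|.
    apply: le_trans (ler_normD _ _) _.
    by rewrite !normrM (ger0_norm k0) (@ger0_norm _ (1 - _)) // subr_ge0.
  apply: le_trans (lerD (tri _ _) (tri _ _)) _; nra.
have sp_abs (g : 'M[R]_3) v : Oh_set g ->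
    (forall i j, i != j -> `|v i 0| + `|v j 0| <= 1) ->
    (forall i j, i != j -> `|(g *m v) i 0| + `|(g *m v) j 0| <= 1).
  move=> [s [e ->]] vC i j ij; rewrite -/(mx (s, e)) !mx_act !normrMsign.
  by apply: vC; rewrite (inj_eq perm_inj).
move=> _ [] [g Og <-]; apply: sp_abs => // i j ij; rewrite !mxE.
  rewrite !eqxx !andbT !normr_nat -natrD lern1.
  case: (eqVneq i 0) ij => [->|_ _]; last exact: leq_b1.
  by rewrite eq_sym => /negPf ->.
by rewrite ger0_norm ?invr_ge0//; lra.
Qed.

(** Complementary slackness: when a nonnegative combination of valid
    inequalities is tight, those with a positive coefficient are tight. *)
Lemma slack (p q p' q' p'' q'' : R) : 0 < p -> 0 <= q ->
  0 <= p' -> 0 <= q' -> 0 <= p'' -> 0 <= q'' ->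
  p * q + p' * q' + p'' * q'' <= 0 -> q = 0.
Proof.
move=> p0 q0 p'0 q'0 p''0 q''0; have := mulr_ge0 p'0 q'0.
have := mulr_ge0 p''0 q''0 => h1 h2 h3.
have : p * q <= 0 by lra.
by rewrite pmulr_rle0// => q0'; apply/eqP; rewrite eq_le q0 q0'.
Qed.

(** Every orbit of signed permutations meets the chamber b0 >= b1 >= b2 >= 0:
    take absolute values, then sort. *)
Lemma dominant_rearrangement a : exists g, let b := mx g *m a in
  [/\ b i1 0 <= b i0 0, b i2 0 <= b i1 0 & 0 <= b i2 0].
Proof.
(* Maximizing a sum with decreasing weights 2, 1, 0 sorts the entries: no
   transposition of neighbours can increase it. *)
pose w (s : 'S_3) := 2 * `|a (s i0) 0| + `|a (s i1) 0|.
have [s _ w_max] := @arg_maxP _ _ _ 1%g xpredT w isT.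
have {}w_max t : w t <= w s by exact: w_max.
exists (s, [ffun i => a (s i) 0 < 0]).
have bE i : (mx (s, [ffun i => a (s i) 0 < 0]) *m a) i 0 = `|a (s i) 0|.
  by rewrite mx_act/= ffunE; case: ltrP => [/ltr0_norm|/ger0_norm] ->;
    rewrite ?mulN1r ?mul1r.
rewrite /= !bE; split=> //.
- by have := w_max (tperm i0 i1 * s)%g; rewrite /w !permM tpermL tpermR; lra.
- have := w_max (tperm i1 i2 * s)%g.
  by rewrite /w !permM tpermL tpermD//; lra.
Qed.

(** The form a is written as a nonnegative combination of valid inequalities
    y_i + y_j <= 1 and y_0 <= 1 in a way that depends on the sign of
    a0 - a1 - a2; on the supporting set the inequalities with positive
    coefficients are equalities.  If a0 > a1 + a2 this leaves the vertex
    (1, 0, 0), if a0 < a1 + a2 the vertex (1/2, 1/2, 1/2), if a0 = a1 + a2 and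
    a2 > 0 the edge between them, and only a = (a0, a0, 0) supports a face. *)
Lemma support_dominant a b :
  a i1 0 <= a i0 0 -> a i2 0 <= a i1 0 -> 0 <= a i2 0 -> a != 0 ->
  (forall y, P y -> dot a y <= b) -> (exists2 y, P y & dot a y = b) ->
  (exists c w, forall y, P y -> dot a y = b -> exists k : R, y = c + k *: w) \/
  (forall y, P y -> dot a y = b <-> y i0 0 + y i1 0 = 1).
Proof.
move=> a10 a21 a2 a_neq0 Pb [y1 Py1 y1b].
have := Pb _ P_vtx; rewrite dotE !mxE/= => bv.
have := Pb _ P_vtx'; rewrite dotE !mxE/= => bv'.
have Pineq y : P y -> [/\ y i0 0 + y i1 0 <= 1, y i0 0 + y i2 0 <= 1,
    y i1 0 + y i2 0 <= 1, y i0 0 - y i1 0 <= 1 & y i0 0 - y i2 0 <= 1].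
  move=> Py; have := @P_abs y i0 i1 Py isT; have := @P_abs y i0 i2 Py isT.
  have := @P_abs y i1 i2 Py isT.
  have := ler_norm (y i0 0); have := ler_norm (y i1 0); have := ler_norm (y i2 0).
  have := ler_norm (- y i1 0); have := ler_norm (- y i2 0); rewrite !normrN.
  by split; lra.
have [lt|ge] := ltrP (a i1 0 + a i2 0) (a i0 0).
  (* a.y = (a0 - a1 - a2) y0 + a1 (y0 + y1) + a2 (y0 + y2) *)
  left; exists (vtx R), 0 => y Py; rewrite dotE => yb.
  exists 0; rewrite scaler0 addr0.
  have [h01 h02 h12 h01' h02'] := Pineq y Py.
  have e : 1 - y i0 0 = 0.
    by apply: (@slack (a i0 0 - a i1 0 - a i2 0) _ (a i1 0) (1 - y i0 0 - y i1 0)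
      (a i2 0) (1 - y i0 0 - y i2 0)); lra.
  by apply/colP; apply: forall_I3; rewrite !mxE/=; lra.
have [lt|ge'] := ltrP (a i0 0) (a i1 0 + a i2 0).
  (* 2 a.y = p01 (y0 + y1) + p02 (y0 + y2) + p12 (y1 + y2) *)
  left; exists (vtx' R), 0 => y Py; rewrite dotE => yb.
  exists 0; rewrite scaler0 addr0.
  have [h01 h02 h12 h01' h02'] := Pineq y Py.
  pose q01 := 1 - y i0 0 - y i1 0; pose q02 := 1 - y i0 0 - y i2 0.
  pose q12 := 1 - y i1 0 - y i2 0.
  pose p01 := a i0 0 + a i1 0 - a i2 0; pose p02 := a i0 0 + a i2 0 - a i1 0.
  pose p12 := a i1 0 + a i2 0 - a i0 0.
  have e01 : q01 = 0.
    by apply: (@slack p01 _ p02 q02 p12 q12);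
      rewrite /p01 /p02 /p12 /q01 /q02 /q12; lra.
  have e02 : q02 = 0.
    by apply: (@slack p02 _ p01 q01 p12 q12);
      rewrite /p01 /p02 /p12 /q01 /q02 /q12; lra.
  have e12 : q12 = 0.
    by apply: (@slack p12 _ p01 q01 p02 q02);
      rewrite /p01 /p02 /p12 /q01 /q02 /q12; lra.
  by move: e01 e02 e12; rewrite /q01 /q02 /q12 => e01 e02 e12;
    apply/colP; apply: forall_I3; rewrite !mxE/=; lra.
have a0E : a i0 0 = a i1 0 + a i2 0 by lra.
have [a2_gt0|a2_le0] := ltrP 0 (a i2 0).
  (* (1, -1, -1) is twice the edge vector from vtx' to vtx *)
  left; exists (vtx R), (\col_i if i == i0 then 1 else -1) => y Py.
  rewrite dotE a0E => yb; exists (y i0 0 - 1); move: bv; rewrite a0E => bv.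
  have [h01 h02 h12 h01' h02'] := Pineq y Py.
  pose q01 := 1 - y i0 0 - y i1 0; pose q02 := 1 - y i0 0 - y i2 0.
  have e01 : q01 = 0.
    by apply: (@slack (a i1 0) _ (a i2 0) q02 0 0); rewrite /q01 /q02; lra.
  have e02 : q02 = 0.
    by apply: (@slack (a i2 0) _ (a i1 0) q01 0 0); rewrite /q01 /q02; lra.
  by move: e01 e02; rewrite /q01 /q02 => e01 e02;
    apply/colP; apply: forall_I3; rewrite !mxE/=; lra.
right => y Py; rewrite dotE.
have a2E : a i2 0 = 0 by lra.
have a0_gt0 : 0 < a i0 0.
  rewrite lt_neqAle andbC; apply/andP; split; first by lra.
  apply: contra_neq a_neq0 => a00; apply/colP; apply: forall_I3; rewrite !mxE; lra.
have bE : b = a i0 0.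
  have [h01 _ _ _ _] := Pineq _ Py1; move: y1b; rewrite dotE.
  have -> : a i1 0 = a i0 0 by lra.
  by rewrite a2E mul0r addr0; nra.
have a1E : a i1 0 = a i0 0 by lra.
rewrite a1E a2E bE mul0r addr0 -mulrDr; split=> [e|->]; last by rewrite mulr1.
by apply: (mulfI (lt0r_neq0 a0_gt0)); rewrite e mulr1.
Qed.
Definition face_set x : set 'cV[R]_3 := [set y | P y /\ dot (vec (val x)) y = 1].

Lemma face_setE x y : face_set x y <-> P y /\ dot (vec (val x)) y = 1.
Proof. by []. Qed.

Lemma face_set_act g x y : face_set (normal_act g x) (mx g *m y) <-> face_set x y.
Proof. by rewrite !face_setE P_mx -mx_vec dot_mx. Qed.

Lemma move_face_set g x : move (mx g) (face_set x) = face_set (normal_act g x).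
Proof.
apply/seteqP; split => [_ [y Fy <-]|y Fy]; first exact/face_set_act.
exists (mx g^-1%g *m y); last by rewrite -{1}[g]invgK mxK.
by apply/(face_set_act g); rewrite -{2}[g]invgK mxK.
Qed.

Lemma vec_base : vec (val base_normal) = \col_i (if i == i2 then 0 else 1).
Proof. by apply/colP; apply: forall_I3; rewrite !mxE ffunE/=. Qed.

Lemma dot_base y : dot (vec (val base_normal)) y = y i0 0 + y i1 0.
Proof. by rewrite vec_base dotE !mxE/= !mul1r mul0r addr0. Qed.

(** The base face is the rhombus vtx, vtx', vtx_opp, vtx'_opp. *)
Definition vtx_opp : 'cV[R]_3 := delta_mx i1 0.
Definition vtx'_opp : 'cV[R]_3 := \col_i (if i == i2 then - 2^-1 else 2^-1).

Lemma mx_base_rE y : mx base_r *m y =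
  \col_i (if i == i0 then y i1 0 else if i == i1 then y i0 0 else - y i2 0).
Proof.
apply/colP; apply: forall_I3; rewrite mx_act !mxE ffunE/=.
- by rewrite tpermL mul1r.
- by rewrite tpermR mul1r.
- by rewrite tpermD// mulN1r.
Qed.

Lemma mx_base_fE y : mx base_f *m y =
  \col_i (if i == i2 then - y i2 0 else y i 0).
Proof.
by apply/colP; apply: forall_I3; rewrite mx_act !mxE ffunE/= perm1 ?mul1r ?mulN1r.
Qed.

Lemma mx_base_rfE y : mx base_rf *m y =
  \col_i (if i == i0 then y i1 0 else if i == i1 then y i0 0 else y i2 0).
Proof.
apply/colP; apply: forall_I3; rewrite mx_act !mxE ffunE/= mul1r.
- by rewrite tpermL.
- by rewrite tpermR.
- by rewrite tpermD.
Qed.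

Lemma mx_r_vtx : mx base_r *m vtx R = vtx_opp.
Proof. by rewrite mx_base_rE; apply/colP; apply: forall_I3; rewrite !mxE/= ?oppr0. Qed.

Lemma mx_f_vtx : mx base_f *m vtx R = vtx R.
Proof. by rewrite mx_base_fE; apply/colP; apply: forall_I3; rewrite !mxE/= ?oppr0. Qed.

Lemma mx_rf_vtx : mx base_rf *m vtx R = vtx_opp.
Proof. by rewrite mx_base_rfE; apply/colP; apply: forall_I3; rewrite !mxE/=. Qed.

Lemma mx_f_vtx_opp : mx base_f *m vtx_opp = vtx_opp.
Proof. by rewrite mx_base_fE; apply/colP; apply: forall_I3; rewrite !mxE/= ?oppr0. Qed.

Lemma mx_r_vtx' : mx base_r *m vtx' R = vtx'_opp.
Proof. by rewrite mx_base_rE; apply/colP; apply: forall_I3; rewrite !mxE/=. Qed.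

Lemma mx_f_vtx' : mx base_f *m vtx' R = vtx'_opp.
Proof. by rewrite mx_base_fE; apply/colP; apply: forall_I3; rewrite !mxE/=. Qed.

Lemma mx_rf_vtx' : mx base_rf *m vtx' R = vtx' R.
Proof. by rewrite mx_base_rfE; apply/colP; apply: forall_I3; rewrite !mxE/=. Qed.

Lemma mx_rf_vtx'_opp : mx base_rf *m vtx'_opp = vtx'_opp.
Proof. by rewrite mx_base_rfE; apply/colP; apply: forall_I3; rewrite !mxE/=. Qed.

Lemma vtx_neq : vtx R != vtx_opp.
Proof.
by apply/eqP => /colP/(_ i0); rewrite !mxE/= => /eqP; rewrite oner_eq0.
Qed.

Lemma vtx'_neq : vtx' R != vtx'_opp.
Proof. by apply/eqP => /colP/(_ i2); rewrite !mxE/=; lra. Qed.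

Lemma base_face_vtx : face_set base_normal (vtx R).
Proof. by split; [exact: P_vtx|rewrite dot_base !mxE/= addr0]. Qed.

Lemma base_face_vtx_opp : face_set base_normal vtx_opp.
Proof. by split; [rewrite -mx_r_vtx P_mx; exact: P_vtx|rewrite dot_base !mxE/= add0r]. Qed.

Lemma base_face_vtx' : face_set base_normal (vtx' R).
Proof. by split; [exact: P_vtx'|rewrite dot_base !mxE/=; lra]. Qed.

Lemma base_face_vtx'_opp : face_set base_normal vtx'_opp.
Proof. by split; [rewrite -mx_f_vtx' P_mx; exact: P_vtx'|rewrite dot_base !mxE/=; lra]. Qed.

Lemma vec_inj : injective vec.
Proof.
move=> x y /colP xy; apply/ffunP => i; have := xy i; rewrite !mxE.
case: (x i) (y i) => [b|] [c|] //= /eqP; last by rewrite eq_sym signr_eq0.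
  by rewrite (inj_eq signr_inj) => /eqP ->.
by rewrite signr_eq0.
Qed.

Lemma face_set_inj : injective face_set.
Proof.
move=> x y; have [h <-] := normal_act_trans x => hxy.
have [z zy] : exists z, y = normal_act h z.
  by exists (normal_act h^-1%g y); rewrite -normal_actM mulgV normal_act1.
move: hxy; rewrite zy => hxy; congr normal_act; apply/val_inj.
have sub v : face_set base_normal v -> dot (vec (val z)) v = 1.
  by move=> /(face_set_act h); rewrite hxy => /(face_set_act h)[].
apply/esym/vec_inj; move: (vec (val z)) sub => v sub.
have := sub _ base_face_vtx; have := sub _ base_face_vtx_opp.
have := sub _ base_face_vtx'; rewrite !dotE vec_base => e e1 e0.
by apply/colP; move: e e1 e0; rewrite !mxE/= => e e1 e0;
  apply: forall_I3; rewrite !mxE/=; lra.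
Qed.

Lemma not_in_line (F : set 'cV[R]_3) (x y z : 'cV[R]_3) c w :
  (forall v, F v -> exists k : R, v = c + k *: w) -> F x -> F y -> F z ->
  (\rank (row_mx (y - x) (z - x)) < 2)%N.
Proof.
move=> Fw /Fw[kx ->] /Fw[ky ->] /Fw[kz ->].
have -> : row_mx (c + ky *: w - (c + kx *: w)) (c + kz *: w - (c + kx *: w))
    = w *m row_mx (ky - kx)%:M (kz - kx)%:M.
  rewrite mul_mx_row !mul_mx_scalar !scalerBl; congr row_mx;
  by rewrite opprD addrACA subrr add0r.
exact: leq_ltn_trans (mulmx_max_rank _ _) _.
Qed.

(** By transitivity it suffices to treat the base face. *)
Lemma is_face_set x : is_face P (face_set x).
Proof.
have [h <-] := normal_act_trans x; rewrite -move_face_set.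
apply: (@face_move _ _ (Oh R) (mx h)) => /=; first exact: Oh_mx.
exists (vec (val base_normal)), 1; split => //.
- apply/eqP => /colP/(_ i0); rewrite vec_base !mxE/= => /eqP.
  by rewrite oner_eq0.
- move=> y Py; rewrite -/(dot _ _) dot_base.
  apply: le_trans (@P_abs y i0 i1 Py isT); apply: lerD; exact: ler_norm.
exists (vtx R), vtx_opp, (vtx' R); split.
- exact: base_face_vtx.
- exact: base_face_vtx_opp.
- exact: base_face_vtx'.
set M := row_mx _ _.
(* A left inverse of the matrix of the two edges at vtx. *)
pose L : 'M[R]_(1 + 1, 3) := col_mx (\row_j (if j == i1 then 0 else -1))
  (\row_j (if j == i2 then 2 else 0)).
have LM : L *m M = 1%:M.
  rewrite mul_col_row -[1%:M]submxK; congr block_mx; apply/matrixP => i j;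
  rewrite !ord1 !mxE !big_ord_recl big_ord0 !mxE/=; lra.
apply/eqP; rewrite eqn_leq rank_leq_col/=.
by have := mxrankM_maxr L M; rewrite LM mxrank1.
Qed.

(** After a signed permutation the normal lies in the dominant chamber, where
    the supporting set is the base face, since a two-dimensional face is not
    contained in a line. *)
Lemma is_faceP F : is_face P F -> exists x, F = face_set x.
Proof.
move=> [a [b [a0 Pb FE [p [q [s [Fp Fq Fs rk]]]]]]].
have [g [a10 a21 a2]] := dominant_rearrangement a.
set a' := mx g *m a in a10 a21 a2.
have gK v : mx g *m (mx g^-1%g *m v) = v by rewrite -{1}[g]invgK mxK.
have a'E y : dot a' y = dot a (mx g^-1%g *m y).
  by rewrite -(dot_mx g a) gK.
have FE' y : F (mx g^-1%g *m y) <-> P y /\ dot a' y = b.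
  by rewrite FE/= P_mx a'E.
have a'_neq0 : a' != 0.
  by apply: contra_neq a0 => a'0; rewrite -(mxK g a) -/a' a'0 mulmx0.
have Pb' y : P y -> dot a' y <= b.
  by move=> Py; rewrite a'E; apply: Pb; apply/P_mx.
have ex_b : exists2 y, P y & dot a' y = b.
  by exists (mx g *m p); apply (FE' _); rewrite mxK.
have [[c [w line]]|base] := support_dominant a10 a21 a2 a'_neq0 Pb' ex_b.
  suff : (\rank (row_mx (q - p) (s - p)) < 2)%N by rewrite rk.
  apply: (@not_in_line F p q s (mx g^-1%g *m c) (mx g^-1%g *m w)) => // v.
  rewrite -(mxK g v) => /FE'[Pv vb]; have [k ->] := line _ Pv vb.
  by exists k; rewrite mulmxDr -scalemxAr.
exists (normal_act g^-1%g base_normal); apply/seteqP.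
suff eqF v : F v <-> face_set (normal_act g^-1%g base_normal) v.
  by split=> v /eqF.
rewrite -(mxK g v) FE' face_set_act face_setE dot_base.
by split=> -[Pv] /(base _ Pv).
Qed.
(** * Recognizing the face symmetries *)

Definition oh g : Oh R := SigSub (mem_set (Oh_mx g) : mx g \in iso_set (Oh R)).

Lemma oh_surj (k : Oh R) : exists g, k = oh g.
Proof.
have [s [e ke]] := set_mem (valP k).
by exists (s, e); apply: val_inj; rewrite /= ke.
Qed.

Lemma oh1 : oh 1%g = iso_one (Oh R).
Proof. by apply: val_inj; rewrite /= mx1. Qed.

Lemma ohM g h : oh (g * h)%g = iso_mul (oh g) (oh h).
Proof. by apply: val_inj; rewrite /= mxM. Qed.

Definition face x : faces P := SigSub (mem_set (is_face_set x) : face_set x \in faces P).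

Lemma face_inj : injective face.
Proof. by move=> x y /(f_equal val) /face_set_inj. Qed.

Lemma face_surj F : exists x, face x = F.
Proof.
have [x Fx] := is_faceP (set_mem (valP F)).
by exists x; apply: val_inj; rewrite /= Fx.
Qed.

Lemma face_act_oh g x : face_act (oh g) (face x) = face (normal_act g x).
Proof. by apply: val_inj; rewrite /= move_face_set. Qed.

Lemma stabilizes_oh g x : stabilizes (oh g) (face x) -> normal_act g x = x.
Proof. by rewrite /stabilizes face_act_oh => /face_inj. Qed.

Lemma Oh_orbit_mx g v : Oh_orbit v (mx g *m v).
Proof. by exists (mx g) => //; exact: Oh_mx. Qed.

Lemma Oh_orbit_vtx g : Oh_orbit (vtx R) (mx g *m vtx_opp).
Proof. by rewrite -mx_r_vtx mulmxA -mxM; exact: Oh_orbit_mx. Qed.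

Lemma Oh_orbit_vtx' g : Oh_orbit (vtx' R) (mx g *m vtx'_opp).
Proof. by rewrite -mx_f_vtx' mulmxA -mxM; exact: Oh_orbit_mx. Qed.

Lemma mx_inj g : injective (fun v : 'cV[R]_3 => mx g *m v).
Proof. by move=> u v /(f_equal (mulmx (mx g^-1%g))); rewrite !mxK. Qed.

Lemma long_endsP h : let F := face (normal_act h base_normal) in
  long_ends F (mx h *m vtx R) /\ long_ends F (mx h *m vtx_opp).
Proof.
split; split.
- by apply/face_set_act; exact: base_face_vtx.
- exact: Oh_orbit_mx.
- by apply/face_set_act; exact: base_face_vtx_opp.
- exact: Oh_orbit_vtx.
Qed.

Lemma short_endsP h : let F := face (normal_act h base_normal) in
  short_ends F (mx h *m vtx' R) /\ short_ends F (mx h *m vtx'_opp).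
Proof.
split; split.
- by apply/face_set_act; exact: base_face_vtx'.
- exact: Oh_orbit_mx.
- by apply/face_set_act; exact: base_face_vtx'_opp.
- exact: Oh_orbit_vtx'.
Qed.

Variant kind_spec : signed_perm -> Prop :=
  | Kind1 : kind_spec 1%g
  | KindR : kind_spec base_r
  | KindF : kind_spec base_f
  | KindRF : kind_spec base_rf.

Lemma kindP g : kind_spec (kind g).
Proof. by rewrite /kind; do 3?case: ifP => _; constructor. Qed.

Lemma stab_mx g h v : (g * h = h * kind g)%g ->
  mx g *m (mx h *m v) = mx h *m (mx (kind g) *m v).
Proof. by move=> gh; rewrite mulmxA -mxM gh mxM mulmxA. Qed.

(** A half-turn about c fixes only the point c of the face, whereas 1, f and rf
    each fix two vertices. *)
Lemma half_turn_kind g x : induces_half_turn (oh g) (face x) -> kind g = base_r.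
Proof.
have [h <-] := normal_act_trans x.
move=> [/stabilizes_oh/stab_kind gh [c Fc turn]].
have center v : face_set base_normal v -> mx (kind g) *m v = v -> mx h *m v = c.
  move=> Fv fix_v; have := turn (mx h *m v) ((face_set_act _ _ _).2 Fv).
  rewrite /= (stab_mx _ gh) fix_v => /eqP; rewrite -subr_eq0 opprK => /eqP e.
  apply/eqP; rewrite -subr_eq0; apply/eqP/colP => i.
  by have /colP/(_ i) := e; rewrite !mxE; lra.
have center2 u v : face_set base_normal u -> face_set base_normal v ->
    mx (kind g) *m u = u -> mx (kind g) *m v = v -> u = v.
  by move=> Fu Fv gu gv; apply: (@mx_inj h); rewrite (center u)// (center v).
case: (kindP g) center2 => // center2; exfalso.
- have := center2 _ _ base_face_vtx base_face_vtx_opp.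
  by rewrite mx1 !mul1mx => /(_ erefl erefl)/eqP; rewrite (negPf vtx_neq).
- have /eqP := center2 _ _ base_face_vtx base_face_vtx_opp mx_f_vtx mx_f_vtx_opp.
  by rewrite (negPf vtx_neq).
- have /eqP := center2 _ _ base_face_vtx' base_face_vtx'_opp mx_rf_vtx' mx_rf_vtx'_opp.
  by rewrite (negPf vtx'_neq).
Qed.

Lemma f_kind g x : induces_f (oh g) (face x) -> kind g = base_f.
Proof.
have [h <-] := normal_act_trans x.
move=> [/stabilizes_oh/stab_kind gh swap fixl].
have [l1 l2] := long_endsP h; have [s1 s2] := short_endsP h.
have := fixl _ l1; rewrite /= (stab_mx _ gh) => /mx_inj fix_v.
have := swap _ _ s1 s2 (fun e => negP vtx'_neq (introT eqP (mx_inj e))).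
rewrite /= (stab_mx _ gh) => /mx_inj.
case: (kindP g) fix_v => //.
- by rewrite mx1 !mul1mx => _ /eqP; rewrite (negPf vtx'_neq).
- by rewrite mx_r_vtx => /esym/eqP; rewrite (negPf vtx_neq).
- by rewrite mx_rf_vtx => /esym/eqP; rewrite (negPf vtx_neq).
Qed.

Lemma rf_kind g x : induces_rf (oh g) (face x) -> kind g = base_rf.
Proof.
have [h <-] := normal_act_trans x.
move=> [/stabilizes_oh/stab_kind gh swap fixs].
have [l1 l2] := long_endsP h; have [s1 s2] := short_endsP h.
have := fixs _ s1; rewrite /= (stab_mx _ gh) => /mx_inj fix_v.
have := swap _ _ l1 l2 (fun e => negP vtx_neq (introT eqP (mx_inj e))).
rewrite /= (stab_mx _ gh) => /mx_inj.
case: (kindP g) fix_v => //.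
- by rewrite mx1 !mul1mx => _ /eqP; rewrite (negPf vtx_neq).
- by rewrite mx_r_vtx' => /esym/eqP; rewrite (negPf vtx'_neq).
- by rewrite mx_f_vtx' => /esym/eqP; rewrite (negPf vtx'_neq).
Qed.

(** * From tile designs to the finite model *)

Section Tilings.
Variables (T : finType) (D : tile_designs (Oh R) T).

Definition design_act g (p : T * normal) : T * normal :=
  ((tile_act D (oh g) (p.1, face p.2)).1, normal_act g p.2).

Lemma tile_act_oh g (c : T) x : tile_act D (oh g) (c, face x) =
  ((design_act g (c, x)).1, face (normal_act g x)).
Proof. by rewrite [LHS]surjective_pairing tile_act_over face_act_oh. Qed.

Lemma design_act1 p : design_act 1%g p = p.
Proof.
by case: p => c x; rewrite /design_act oh1 tile_act1 normal_act1.
Qed.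

Lemma design_actM g h p : design_act (g * h)%g p = design_act g (design_act h p).
Proof.
by case: p => c x; rewrite /design_act ohM tile_actM normal_actM/= tile_act_oh.
Qed.

Lemma design_act_over g p : (design_act g p).2 = normal_act g p.2.
Proof. by []. Qed.

Local Notation act := (tiling_action design_act1 design_actM design_act_over).

Lemma num_fixed_designsE g x : normal_act g x = x ->
  num_fixed_designs D (oh g) (face x) =
    #|fixed_designs design_act (kind g) base_normal|.
Proof.
move=> gx; rewrite -(card_fixed_designs design_act1 design_actM design_act_over gx).
apply: eq_card => c; rewrite !inE; apply/asboolP/eqP => e.
  by rewrite /design_act /= e gx.
by rewrite tile_act_oh e gx.
Qed.

Definition face_index (F : faces P) : normal := projT1 (cid (face_surj F)).

Lemma faceK : cancel face face_index.
Proof. by move=> x; apply: face_inj; rewrite /face_index; case: cid. Qed.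

Lemma face_indexK : cancel face_index face.
Proof. by move=> F; rewrite /face_index; case: cid. Qed.

Definition tiling_of (tau : {ffun normal -> T}) : tiling P T := tau \o face_index.

Lemma tiling_of_face tau x : tiling_of tau (face x) = tau x.
Proof. by rewrite /tiling_of /= faceK. Qed.

Lemma tiling_of_inj : injective tiling_of.
Proof.
move=> tau tau' e; apply/ffunP => x.
by rewrite -!tiling_of_face e.
Qed.

Lemma tiling_of_surj (sigma : tiling P T) : exists tau, tiling_of tau = sigma.
Proof.
exists [ffun x => sigma (face x)]; apply/funext => F.
by rewrite /tiling_of /= ffunE face_indexK.
Qed.

(** [tiling_act] acts on the right, so it undoes the move by g. *)
Lemma tiling_movedE g tau tau' :
  tiling_moved D (oh g) (tiling_of tau) (tiling_of tau') <-> act tau' g = tau.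
Proof.
split=> [moved|<- F].
  apply: (tiling_act_eq design_act1 design_actM design_act_over) => x.
  have := moved (face x).
  rewrite face_act_oh tile_act_oh !tiling_of_face => -[->].
  exact: surjective_pairing.
rewrite -(face_indexK F) face_act_oh tile_act_oh !tiling_of_face.
by rewrite (tiling_actE design_act1 design_actM design_act_over).
Qed.

Definition tilings_in (O : {set {ffun normal -> T}}) : set (tiling P T) :=
  [set tiling_of tau | tau in [set tau | tau \in O]].

Lemma tilings_in_inj : injective tilings_in.
Proof.
move=> O O' eO; apply/setP => tau.
have memO U : tilings_in U (tiling_of tau) <-> tau \in U.
  by split=> [[tau' + /tiling_of_inj <-]|tauU] //; exists tau.
by apply/idP/idP => /memO; [rewrite eO|rewrite -eO] => /memO.
Qed.

Lemma tiling_orbitE tau :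
  tiling_orbit D (tiling_of tau) =
    tilings_in (orbit act [set: signed_perm]%SET tau).
Proof.
apply/seteqP; split=> [sigma [k]|_ [tau' + <-]].
  have [g ->] := oh_surj k; have [tau' <-] := tiling_of_surj sigma.
  move=> /tiling_movedE e; exists tau' => //=.
  by rewrite orbit_sym; apply/orbitP; exists g => //; rewrite inE.
rewrite /= orbit_sym => /orbitP[g _ e].
by exists (oh g); apply/tiling_movedE.
Qed.

Lemma tiling_orbitsE : tiling_orbits D = [set tilings_in O | O in
  [set O | O \in orbit act [set: signed_perm]%SET @: [set: {ffun normal -> T}]%SET]].
Proof.
apply/seteqP; split=> [_ [sigma _ <-]|_ [O /imsetP[tau _ ->] <-]].
  have [tau <-] := tiling_of_surj sigma; rewrite tiling_orbitE.
  by exists (orbit act [set: signed_perm]%SET tau) => //=; rewrite imset_f ?inE.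
by exists (tiling_of tau) => //; rewrite tiling_orbitE.
Qed.

Lemma card_tiling_orbits_act : (tiling_orbits D #=
  `I_#|orbit act [set: signed_perm]%SET @: [set: {ffun normal -> T}]%SET|)%card.
Proof.
rewrite tiling_orbitsE; set B := orbit _ _ @: _.
apply: card_eq_trans; first by apply: inj_card_eq => O O' _ _; exact: tilings_in_inj.
have -> : [set O | O \in B] = [set` [fset O in B]%fset].
  by apply/seteqP; split=> O /=; rewrite !inE.
apply/card_eq_fsetP; exact: card_finset.
Qed.

End Tilings.
End Faces.

Theorem theorem6 (R : realType) (T : finType) (D : tile_designs (Oh R) T)
    (F : faces (rhombic_dodecahedron R)) (r f rf : Oh R)
    (t_id t_r t_f t_rf : nat)
    (hr : induces_half_turn r F)
    (hf : induces_f f F)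
    (hrf : induces_rf rf F)
    (ht_id : t_id = #|T|)
    (ht_r : t_r = num_fixed_designs D r F)
    (ht_f : t_f = num_fixed_designs D f F)
    (ht_rf : t_rf = num_fixed_designs D rf F) :
  exists N : nat,
    [/\ (tiling_orbits D #= `I_N)%card,
        N%:R = 1 / 48 *
          (t_id%:R ^+ 12 + 6 * t_id%:R ^+ 3 + 3 * t_id%:R ^+ 6
           + 8 * t_id%:R ^+ 4 + 6 * t_id%:R ^+ 5 * t_r%:R ^+ 2
           + t_id%:R ^+ 6 + 6 * t_id%:R ^+ 3
           + 3 * t_id%:R ^+ 4 * t_f%:R ^+ 4 + 8 * t_id%:R ^+ 2
           + 6 * t_id%:R ^+ 5 * t_rf%:R ^+ 2) :> rat &
        N%:R = 1 / 48 *
          (t_id%:R ^+ 12 + 4 * t_id%:R ^+ 6 + 8 * t_id%:R ^+ 4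
           + 12 * t_id%:R ^+ 3 + 8 * t_id%:R ^+ 2
           + 6 * t_id%:R ^+ 5 * t_r%:R ^+ 2
           + 3 * t_id%:R ^+ 4 * t_f%:R ^+ 4
           + 6 * t_id%:R ^+ 5 * t_rf%:R ^+ 2) :> rat].
Proof.
move: hr hf hrf ht_r ht_f ht_rf; have [x <-] := face_surj F.
have [g ->] := oh_surj r; have [h ->] := oh_surj f; have [k ->] := oh_surj rf.
move=> hr hf hrf.
have [/stabilizes_oh gx _] := hr; have [/stabilizes_oh hx _ _] := hf.
have [/stabilizes_oh kx _ _] := hrf.
rewrite !num_fixed_designsE// (half_turn_kind hr) (f_kind hf) (rf_kind hrf).
move=> t_rE t_fE t_rfE.
have := card_tiling_orbits (design_act1 D) (design_actM D) (design_act_over D).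
rewrite -ht_id -t_rE -t_fE -t_rfE /=; set N := #|_ @: _| => count.
have {count}N48 : N%:R * 48 = t_id%:R ^+ 12 + 4 * t_id%:R ^+ 6
    + 8 * t_id%:R ^+ 4 + 12 * t_id%:R ^+ 3 + 8 * t_id%:R ^+ 2
    + 6 * t_id%:R ^+ 5 * t_r%:R ^+ 2 + 3 * t_id%:R ^+ 4 * t_f%:R ^+ 4
    + 6 * t_id%:R ^+ 5 * t_rf%:R ^+ 2 :> rat.
  by rewrite -!natrX -!natrM -!natrD count.
exists N; split; first exact: card_tiling_orbits_act.
- by apply: (mulIf (_ : 48 != 0)) => //; rewrite N48; field.
- by apply: (mulIf (_ : 48 != 0)) => //; rewrite N48; field.
Qed.
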